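(* Let $M=x_0^{a_0}x_1^{a_1}x_2^{a_2}\in\mathbb{C}[x_0,x_1,x_2]$ be a monomial of degree $3d$. Then: (1) $\#_3(M)=1$ if $M$ is a pure cube; (2) $\#_3(M)=4$ if $M=x_0x_1x_2$; (3) $\#_3(M)=3$ otherwise.
   Context: Exponents of monomials are non-negative integers; a monomial is a pure cube if it is the cube of a monomial. A form of degree $d$ is a homogeneous polynomial of degree $d$ with complex coefficients (forms of degree $0$ are constants). For a form $F\in\mathbb{C}[x_0,x_1,x_2]$ of degree $3d$, the $3^{rd}$-Waring rank of $F$ is $\#_3(F):=\min\{s \mid F=g_1^3+\cdots+g_s^3 \text{ for some forms } g_1,\ldots,g_s\in\mathbb{C}[x_0,x_1,x_2] \text{ of degree } d\}$. *)

(* Defs.v *)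
From mathcomp Require Import all_boot all_order all_algebra.
From mathcomp Require Import reals.
From mathcomp Require Import complex.
From mathcomp.multinomials Require Import mpoly.

Set Implicit Arguments.
Unset Strict Implicit.
Unset Printing Implicit Defensive.

Import GRing.Theory.
Local Open Scope ring_scope.

Definition o0 : 'I_3 := @Ordinal 3 0 isT.
Definition o1 : 'I_3 := @Ordinal 3 1 isT.
Definition o2 : 'I_3 := @Ordinal 3 2 isT.

(* [s] cubes suffice for [F].  The predicate [d.-homog] of mpoly also holds of
   the zero polynomial, which does not affect the minimum below. *)
Definition sum_of_cubes (R : realType) (d : nat) (F : {mpoly R[i][3]})
    (s : nat) : Prop :=
  exists g : 'I_s -> {mpoly R[i][3]},
    (forall j, g j \is d.-homog) /\ F = \sum_(j < s) g j ^+ 3.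

(* The set of admissible [s] is not known a priori to be nonempty, so
   "#_3(F) = s" is the relation "[s] is the minimum of that set". *)
Definition waring3_rank_is (R : realType) (d : nat) (F : {mpoly R[i][3]})
    (s : nat) : Prop :=
  sum_of_cubes d F s /\ forall t : nat, sum_of_cubes d F t -> (s <= t)%N.

Definition pure_cube (R : realType) (F : {mpoly R[i][3]}) : Prop :=
  exists m : 'X_{1..3}, F = 'X_[m] ^+ 3.

(* Main.v *)
Require Import Defs.
From mathcomp Require Import all_boot all_order all_algebra.
From mathcomp Require Import reals.
From mathcomp Require Import complex.
From mathcomp.multinomials Require Import mpoly.
From mathcomp Require Import ring zify.

Import Order.TTheory GRing.Theory Num.Theory.
Local Open Scope ring_scope.

(** Upper bounds.  The identity
      [6 u^2 v = (u + v)^3 + (v - u)^3 - 2 v^3]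
    shows that [n^3 u^2 v] is a sum of three cubes of forms as soon as [u] and
    [v] have the same degree, cube roots of constants being available.
    Every monomial of degree [3d] other than [x0 x1 x2] has this shape with
    [n], [u], [v] monomials ([exponent_decomposition]); for instance
    [x0 x1^2 = u^2 v] with [u = x1], [v = x0], while
    [x0^2 x1^2 x2^2 = (x0 x1)^2 (x2^2)] and [x0^4 x1 x2 = (x0^2)^2 (x1 x2)].
    For [x0 x1 x2], four cubes come from expressing [24 x0 x1 x2] through the
    cubes of [x0 + x1 + x2] and its sign variants.

    Two cubes are not enough unless the monomial is a pure cube.  With [w] a
    primitive cube root of unity, [g^3 + h^3] is the product of [g + h],
    [g + w h] and [g + w^2 h].  A factor of a monomial is a scaled monomial
    ([monomial_factor]), and the three factors are linearly dependent with
    nonzero coefficients, which forces the three monomials to be equal: their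
    product is a pure cube ([two_cubes_monomial]).

    Three cubes are not enough for [x0 x1 x2] ([product_not_three_cubes]).
    Polarizing [x0 x1 x2 = l_0^3 + l_1^3 + l_2^3], where the [l_j] are linear
    forms, gives a trilinear identity.  Evaluated at [(e_0, e_0, x)], it says
    that the squares [l_j(e_0)^2] are the coefficients of a linear relation
    between the [l_j]; that relation is nontrivial since the mixed term at
    [(e_0, e_1, e_2)] does not vanish.  Hence the [l_j] have a common zero
    [v <> 0], but the identity at [(v, e_k, e_l)] says that all the coordinates
    of [v] vanish. *)

(** * Factors of monomials *)

(** For the monomial order, the sum of the least exponents is reached by no
    other pair of exponents. *)
Lemma mcoeffM_mlast (n : nat) (A : nzRingType) (p q : {mpoly A[n]}) :
  (p * q)@_(mlast p + mlast q) = p@_(mlast p) * q@_(mlast q).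
Proof.
have [->|nz_p] := eqVneq p 0; first by rewrite !(mul0r, mcoeff0).
have [->|nz_q] := eqVneq q 0; first by rewrite !(mulr0, mcoeff0).
rewrite mpolyME (bigD1_seq (mlast p, mlast q)) /=; first last.
- by rewrite allpairs_uniq => // -[? ?] [].
- by rewrite allpairs_f // !mlast_supp.
rewrite mcoeffD mcoeffZ mcoeffX eqxx mulr1 big_seq_cond raddf_sum /= big1 ?addr0 //.
move=> k /andP[/allpairsP[[m1 m2] /= [/mlast_lemc le1 /mlast_lemc le2 ->]]] /= ne.
rewrite mcoeffZ mcoeffX; case: eqP => [eqm|_]; last by rewrite mulr0.
move: le1; rewrite le_eqVlt => /predU1P[E1|lt1].
  by move: eqm ne; rewrite -E1 => /eqP; rewrite eqm_add2l => /eqP ->; rewrite eqxx.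
by have := ltmc_le_add lt1 le2; rewrite eqm ltxx.
Qed.

(** Leading and trailing exponents are both additive, and they agree on a
    product that is a monomial; hence they agree on each factor. *)
Lemma monomial_factor (n : nat) (A : idomainType) (p q : {mpoly A[n]})
  (m : 'X_{1..n}) :
  p * q = 'X_[m] -> exists k, exists2 c : A, c != 0 & p = c *: 'X_[k].
Proof.
move=> pq; have: p * q != 0 by rewrite pq -msupp_eq0 msuppX.
rewrite mulf_eq0 negb_or => /andP[nz_p nz_q].
have lead_m : m = (mlead p + mlead q)%MM by rewrite -mleadM // pq mleadXm.
have last_m : m = (mlast p + mlast q)%MM.
  have := mcoeffM_mlast _ _ p q; rewrite pq mcoeffX; case: eqP => // _ /esym/eqP.
  by rewrite mulf_eq0 !mcoeff_eq0 !mlast_supp.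
have le_ll (r : {mpoly A[n]}) : r != 0 -> (mlast r <= mlead r)%O.
  by move=> /mlead_supp/mlast_lemc.
have single : mlast p = mlead p.
  apply/eqP; have := le_ll p nz_p; rewrite le_eqVlt => /orP[//|lt_p].
  by have := ltmc_le_add lt_p (le_ll q nz_q); rewrite -lead_m -last_m ltxx.
exists (mlead p), p@_(mlead p); first by rewrite mleadc_eq0.
apply/mpolyP => k; rewrite mcoeffZ mcoeffX; case: eqP => [<-|ne]; rewrite ?mulr1 //.
rewrite mulr0; apply/eqP; rewrite mcoeff_eq0; apply/negP => kp; apply: ne.
by apply/le_anti; rewrite -{1}single mlast_lemc ?msupp_le_mlead.
Qed.

Lemma mpolyX_inj (n : nat) (A : nzRingType) :
  injective (fun m : 'X_{1..n} => 'X_[m] : {mpoly A[n]}).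
Proof.
move=> m k /= /(congr1 (mcoeff m))/esym; rewrite !mcoeffX eqxx.
by case: eqP => // _ /eqP; rewrite eq_sym oner_eq0.
Qed.

(** * Sums of two cubes *)

Lemma primitive_cube_root (K : closedFieldType) : exists w : K, w ^+ 2 + w + 1 = 0.
Proof.
have [w] := @solve_monicpoly K 2%N (fun=> -1) isT.
by rewrite !big_ord_recl big_ord0 => E; exists w; rewrite E /= /bump /=; ring.
Qed.

(** A monomial different from the other two would survive in the sum with its
    nonzero coefficient. *)
Lemma dependent_monomials (n : nat) (A : idomainType) (a b c : A)
  (k l m : 'X_{1..n}) : a != 0 -> b != 0 -> c != 0 ->
  a *: 'X_[k] + b *: 'X_[l] + c *: 'X_[m] = 0 :> {mpoly A[n]} ->
  l = k /\ m = k.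
Proof.
move=> a0 b0 c0 rel; have at_ x := congr1 (mcoeff x) rel.
move: (at_ k) (at_ l) (at_ m); rewrite !mcoeffD !mcoeffZ !mcoeffX !mcoeff0 !eqxx.
have [->|lk] := eqVneq l k.
  have [->|mk] := eqVneq m k; first by [].
  move=> _ _ /eqP; rewrite !mulr0 ?addr0 ?add0r mulr1.
  by rewrite (negPf c0).
have [->|mk] := eqVneq m k.
  move=> _ /eqP; rewrite [k == l]eq_sym (negPf lk) !mulr0 addr0 add0r mulr1.
  by rewrite (negPf b0).
by move=> /eqP; rewrite !mulr0 ?addr0 ?add0r mulr1 (negPf a0).
Qed.

(** The factors [g + h], [g + w h], [g + w^2 h] of [g^3 + h^3] are scaled
    monomials, and [1 + w + w^2 = 0] makes them linearly dependent with
    coefficients [1], [w], [w^2]. *)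
Lemma two_cubes_monomial (n : nat) (K : closedFieldType) (g h : {mpoly K[n]})
  (m : 'X_{1..n}) : g ^+ 3 + h ^+ 3 = 'X_[m] -> exists k, m = (k *+ 3)%MM.
Proof.
move=> eqm; have [w w_root] := primitive_cube_root K.
pose W : {mpoly K[n]} := w%:MP.
have W_root : W ^+ 2 + W + 1 = 0.
  by rewrite -(mpolyC0 n K) -w_root !rmorphD rmorphXn rmorph1.
have W3 : W ^+ 3 = 1.
  apply/eqP; rewrite -subr_eq0; apply/eqP.
  by rewrite -[RHS](mulr0 (W - 1)) -W_root; ring.
have nz_w : w != 0.
  by apply: contra_eq_neq w_root => ->; rewrite expr0n /= !add0r oner_eq0.
pose L (c : {mpoly K[n]}) := g + c * h.
have prodL : L 1 * L W * L (W ^+ 2) = 'X_[m].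
  rewrite -eqm /L.
  transitivity (g ^+ 3 + (1 + W + W ^+ 2) * (g ^+ 2 * h + W * g * h ^+ 2)
                + W ^+ 3 * h ^+ 3); first by ring.
  by rewrite W3 [1 + W + W ^+ 2]addrC [1 + W]addrC addrA W_root; ring.
have [k0 [c0 nz0 E0]] : exists k, exists2 c : K, c != 0 & L 1 = c *: 'X_[k].
  by apply: (monomial_factor _ _ _ (L W * L (W ^+ 2)) m); rewrite -prodL; ring.
have [k1 [c1 nz1 E1]] : exists k, exists2 c : K, c != 0 & L W = c *: 'X_[k].
  by apply: (monomial_factor _ _ _ (L 1 * L (W ^+ 2)) m); rewrite -prodL; ring.
have [k2 [c2 nz2 E2]] : exists k, exists2 c : K, c != 0 & L (W ^+ 2) = c *: 'X_[k].
  by apply: (monomial_factor _ _ _ (L 1 * L W) m); rewrite -prodL; ring.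
have [k10 k20] : k1 = k0 /\ k2 = k0.
  apply: (@dependent_monomials _ _ c0 (w * c1) (w ^+ 2 * c2)).
  - by [].
  - by rewrite mulf_neq0.
  - by rewrite mulf_neq0 ?expf_neq0.
  rewrite -!scalerA -E0 -E1 -E2 -!mul_mpolyC -/W /L.
  transitivity ((W ^+ 2 + W + 1) * (g + (W ^+ 2 - W + 1) * h)); first by ring.
  by rewrite W_root mul0r.
exists k0; move: prodL; rewrite E0 E1 E2 k10 k20.
rewrite -!scalerAl -!scalerAr -!scalerAl -!mpolyXD !scalerA.
move=> /(congr1 (mcoeff m)); rewrite mcoeffZ !mcoeffX eqxx; case: eqP => [<- _|_].
  by rewrite !mulmS; apply/mnmP => i; rewrite !mnmE; lia.
by rewrite mulr0 => /esym/eqP; rewrite oner_eq0.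
Qed.

(** * The product of three variables *)

Lemma linear_form_meval (n : nat) (A : comNzRingType) (p : {mpoly A[n]})
  (v : 'I_n -> A) :
  p \is 1.-homog -> p.@[v] = \sum_i v i * p@_U_(i).
Proof.
move=> hp; have {1}-> : p = \sum_i p@_U_(i) *: 'X_i.
  apply/mpolyP => m; rewrite raddf_sum /=.
  under eq_bigr do rewrite mcoeffZ mcoeffX.
  have [/mdeg1P[j /eqP ->]|dm] := boolP (mdeg m == 1%N).
    rewrite (bigD1 j) //= eqxx mulr1 big1 ?addr0 // => i ij.
    by rewrite eq_mnm1 (negPf ij) mulr0.
  rewrite (dhomog_nemf_coeff hp dm) big1 // => i _.
  by case: eqP => [E|_]; rewrite ?mulr0 //; move: dm; rewrite -E mdeg1.
by rewrite raddf_sum; apply: eq_bigr => i _; rewrite /= mevalZ mevalXU mulrC.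
Qed.

(** Column [j] of [B] holds the coefficients of the [j]-th linear form.  The
    polarization by inclusion-exclusion over sums of arguments yields
    [6 x y z] without any division, so the field may have characteristic 2
    or 3. *)
Lemma product_not_three_cubes (K : fieldType) (B : 'M[K]_3) :
  ~ (forall v : 'rV[K]_3,
       v 0 o0 * v 0 o1 * v 0 o2 = \sum_j ((v *m B) 0 j) ^+ 3).
Proof.
move=> cubes.
have polar (u v w : 'rV[K]_3) :
    6%:R * (\sum_j (u *m B) 0 j * (v *m B) 0 j * (w *m B) 0 j) =
    u 0 o0 * v 0 o1 * w 0 o2 + u 0 o0 * v 0 o2 * w 0 o1 +
    u 0 o1 * v 0 o0 * w 0 o2 + u 0 o1 * v 0 o2 * w 0 o0 +
    u 0 o2 * v 0 o0 * w 0 o1 + u 0 o2 * v 0 o1 * w 0 o0.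
  pose S (x : 'rV[K]_3) := \sum_j ((x *m B) 0 j) ^+ 3.
  transitivity (S (u + v + w) - (S (u + v) + S (u + w) + S (v + w))
                + (S u + S v + S w)); last by rewrite /S -!cubes !mxE; ring.
  rewrite /S -!big_split -sumrB -big_split mulr_sumr /=.
  by apply: eq_bigr => j _; rewrite !mulmxDl !mxE; ring.
pose e (i : 'I_3) : 'rV[K]_3 := delta_mx 0 i.
have eB i j : (e i *m B) 0 j = B i j by rewrite -rowE mxE.
(* The coefficients of a linear relation between the three forms. *)
pose c : 'cV[K]_3 := \col_j (B o0 j ^+ 2).
have Bc : 6%:R *: (B *m c) = 0.
  apply/matrixP => i k; rewrite !mxE.
  have := polar (e o0) (e o0) (e i); rewrite !mxE !eqxx /= !(mul0r, mulr0, addr0).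
  move=> E; rewrite -[RHS]E; congr (_ * _).
  by apply: eq_bigr => j _; rewrite [c _ _]mxE !eB; ring.
have nz_c : 6%:R *: c != 0.
  apply/eqP => c0; suff: (1 : K) = 0 by move/eqP; rewrite oner_eq0.
  have := polar (e o0) (e o1) (e o2); rewrite !mxE !eqxx /= !(mul0r, mulr0, addr0, mulr1).
  move=> E; rewrite -[LHS]E mulr_sumr big1 // => j _.
  rewrite !eB; have /matrixP/(_ j 0) := c0; rewrite !mxE => c0j.
  have [->|nzb] := eqVneq (B o0 j) 0; first by rewrite !mul0r mulr0.
  move/eqP: c0j; rewrite mulf_eq0 expf_eq0 (negPf nzb) orbF => /eqP ->.
  by rewrite mul0r.
have /det0P[v nz_v vB] : \det B == 0.
  apply: contraNT nz_c => nz_det.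
  have unitB : B \in unitmx by rewrite unitmxE unitfE.
  by rewrite -(mulKmx unitB (6%:R *: c)) -scalemxAr Bc mulmx0.
case/eqP: nz_v; apply/rowP => i; rewrite mxE.
have kill k l : 0 =
    v 0 o0 * e k 0 o1 * e l 0 o2 + v 0 o0 * e k 0 o2 * e l 0 o1 +
    v 0 o1 * e k 0 o0 * e l 0 o2 + v 0 o1 * e k 0 o2 * e l 0 o0 +
    v 0 o2 * e k 0 o0 * e l 0 o1 + v 0 o2 * e k 0 o1 * e l 0 o0.
  by rewrite -polar vB big1 ?mulr0 // => j _; rewrite !mxE !mul0r.
have := (kill o1 o2, kill o0 o2, kill o0 o1); rewrite !mxE !eqxx /=.
rewrite !(mul0r, mulr0, mulr1, addr0, add0r).
by case: i => -[|[|[|//]]] i [[v0 v1] v2];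
  [rewrite [RHS]v0 | rewrite [RHS]v1 | rewrite [RHS]v2]; congr (v _ _); apply: val_inj.
Qed.

(** * Explicit sums of three and four cubes *)

Lemma cube_root (K : closedFieldType) (a : K) : exists c, c ^+ 3 = a.
Proof.
have [c] := @solve_monicpoly K 3%N (fun i => if i is 0%N then a else 0) isT.
rewrite !big_ord_recl big_ord0 /= /bump /= !mul0r !addr0 mulr1 => E.
by exists c.
Qed.

Lemma sqr_mul_three_cubes (A : comNzRingType) (a b n u v : A) :
  6%:R * a ^+ 3 = 1 -> b ^+ 3 = - 2%:R * a ^+ 3 ->
  n ^+ 3 * u ^+ 2 * v =
  \sum_(g <- [:: a * (n * u + n * v); a * (n * v - n * u); b * (n * v)]) g ^+ 3.
Proof.
move=> a3 b3; rewrite !big_cons big_nil [(b * _) ^+ 3]exprMn b3.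
transitivity (6%:R * a ^+ 3 * (n ^+ 3 * u ^+ 2 * v)); last by ring.
by rewrite a3 mul1r.
Qed.

Lemma product_four_cubes (A : comNzRingType) (a x y z : A) :
  24%:R * a ^+ 3 = 1 ->
  x * y * z = \sum_(g <- [:: a * (x + y + z); a * (x - y - z);
                             a * (y - x - z); a * (z - x - y)]) g ^+ 3.
Proof.
move=> a3; rewrite !big_cons big_nil.
transitivity (24%:R * a ^+ 3 * (x * y * z)); last by ring.
by rewrite a3 mul1r.
Qed.

(** The exponents add up to a multiple of 3, so their residues are [(0,0,0)],
    a permutation of [(0,1,2)], [(1,1,1)] or [(2,2,2)].  When the residues [1]
    and [2] occur equally often, put variables of residue [1] in [v] and those
    of residue [2] in [u]; [(2,2,2)] splits as [2 (1,1,0) + (0,0,2)]; and for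
    [(1,1,1)] some exponent is at least [4 = 2 * 2], which balances two
    exponents [1]. *)
Lemma exponent_decomposition d (m : 'X_{1..3}) : mdeg m = (3 * d)%N ->
  m <> (U_(o0) + U_(o1) + U_(o2))%MM ->
  exists n u v : 'X_{1..3}, [/\ m = (n *+ 3 + u *+ 2 + v)%MM, mdeg u = mdeg v
    & (mdeg n + mdeg u)%N = d].
Proof.
move=> dm nxyz.
pose triple x y z : 'X_{1..3} := [multinom nth 0%N [:: x; y; z] i | i < 3].
have triple_eq (k : 'X_{1..3}) x y z : k o0 = x -> k o1 = y -> k o2 = z ->
    k = triple x y z.
  move=> k0 k1 k2; apply/mnmP => i; rewrite mnmE.
  by case: i => -[|[|[|//]]] lti; [rewrite -k0|rewrite -k1|rewrite -k2];
    congr (k _); apply: val_inj.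
have mdeg3 (k : 'X_{1..3}) : mdeg k = (k o0 + k o1 + k o2)%N.
  rewrite mdegE !big_ord_recl big_ord0 addn0 addnA.
  by congr (k _ + k _ + k _)%N; apply: val_inj.
(* [x] and [y] are the exponents of [u] and [v]; [n^3] absorbs the rest. *)
suff [[[x0 x1] x2] [[[y0 y1] y2] []]] : exists x y : nat * nat * nat,
    [/\ (x.1.1 + x.1.2 + x.2 = y.1.1 + y.1.2 + y.2)%N,
      (2 * x.1.1 + y.1.1 <= m o0)%N /\ m o0 = 2 * x.1.1 + y.1.1 %[mod 3],
      (2 * x.1.2 + y.1.2 <= m o1)%N /\ m o1 = 2 * x.1.2 + y.1.2 %[mod 3]
    & (2 * x.2 + y.2 <= m o2)%N /\ m o2 = 2 * x.2 + y.2 %[mod 3]].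
  move=> /= xy h0 h1 h2.
  pose n := triple ((m o0 - (2 * x0 + y0)) %/ 3)%N
    ((m o1 - (2 * x1 + y1)) %/ 3)%N ((m o2 - (2 * x2 + y2)) %/ 3)%N.
  exists n, (triple x0 x1 x2), (triple y0 y1 y2).
  move: dm; rewrite !mdeg3 !mnmE /= => dm; split; try lia.
  rewrite [LHS](triple_eq _ _ _ _ erefl erefl erefl).
  by apply/esym/triple_eq; rewrite !(mnmDE, mnmE) /=; lia.
have not111 : ~ [/\ m o0 = 1, m o1 = 1 & m o2 = 1]%N.
  case=> m0 m1 m2; apply: nxyz; rewrite (triple_eq m _ _ _ m0 m1 m2).
  by apply/esym/triple_eq; rewrite !mnmDE !mnm1E.
move: dm; rewrite mdeg3; move: (m o0) (m o1) (m o2) not111 => a b c not111 dm.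
have [balanced|unbalanced] :=
  eqVneq ((a %% 3 == 2) + (b %% 3 == 2) + (c %% 3 == 2))%N
         ((a %% 3 == 1) + (b %% 3 == 1) + (c %% 3 == 1))%N.
  exists (nat_of_bool (a %% 3 == 2), nat_of_bool (b %% 3 == 2),
          nat_of_bool (c %% 3 == 2))%N.
  exists (nat_of_bool (a %% 3 == 1), nat_of_bool (b %% 3 == 1),
          nat_of_bool (c %% 3 == 1))%N.
  by split=> //=; lia.
have [a2|a1] := eqVneq (a %% 3)%N 2%N.
  by exists (1, 1, 0)%N, (0, 0, 2)%N; split=> //=; lia.
have [a4|a4] := leqP 4 a.
  by exists (2, 0, 0)%N, (0, 1, 1)%N; split=> //=; lia.
have [b4|b4] := leqP 4 b.
  by exists (0, 2, 0)%N, (1, 0, 1)%N; split=> //=; lia.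
have [c4|c4] := leqP 4 c.
  by exists (0, 0, 2)%N, (1, 1, 0)%N; split=> //=; lia.
by case: not111; split; lia.
Qed.

(** * Bounds on the number of cubes *)

Section SumsOfCubes.
Variable R : realType.
Implicit Types F : {mpoly R[i][3]}.

Lemma sum_of_cubes_tuple d F s (t : s.-tuple {mpoly R[i][3]}) :
  all (fun g => g \is d.-homog) t -> F = \sum_(g <- t) g ^+ 3 ->
  sum_of_cubes d F s.
Proof.
move=> ht ->; exists (tnth t); split=> [j|]; last by rewrite big_tuple.
by move/all_tnthP: ht; apply.
Qed.

Lemma sum_of_cubes_leq d F s t :
  (s <= t)%N -> sum_of_cubes d F s -> sum_of_cubes d F t.
Proof.
move=> /subnKC <- [g [hg ->]].
exists (fun i => if split i is inl j then g j else 0); split=> [i|].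
  by case: (split i) => [j|_]; [apply: hg | apply: dhomog0].
rewrite big_split_ord /= [X in _ = _ + X]big1 => [|i _].
  by rewrite addr0; apply: eq_bigr => i _; rewrite (unsplitK (inl i)).
by rewrite (unsplitK (inr i)) expr0n.
Qed.

Lemma sum_of_three_cubes_mnm d (n u v : 'X_{1..3}) :
  mdeg u = mdeg v -> (mdeg n + mdeg u = d)%N ->
  sum_of_cubes d ('X_[(n *+ 3 + u *+ 2 + v)%MM] : {mpoly R[i][3]}) 3.
Proof.
move=> uv nu; have [a a3] := cube_root _ (6%:R^-1 : R[i]).
have [b b3] := cube_root _ (- 2%:R * a ^+ 3).
pose N : {mpoly R[i][3]} := 'X_[n]; pose U : {mpoly R[i][3]} := 'X_[u].
pose V : {mpoly R[i][3]} := 'X_[v].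
have hU : N * U \is d.-homog by rewrite -mpolyXD dhomogX /= mdegD nu.
have hV : N * V \is d.-homog by rewrite -mpolyXD dhomogX /= mdegD -uv nu.
apply: (@sum_of_cubes_tuple _ _ _ [tuple a%:MP * (N * U + N * V);
  a%:MP * (N * V - N * U); b%:MP * (N * V)]).
  by rewrite /= !mul_mpolyC !dhomogZ // ?rpredB ?rpredD.
have -> : 'X_[(n *+ 3 + u *+ 2 + v)%MM] = N ^+ 3 * U ^+ 2 * V.
  by rewrite !mpolyXn -!mpolyXD.
apply: sqr_mul_three_cubes.
  rewrite -rmorphXn a3 -(rmorph_nat (mpolyC 3 (R:=R[i]))) -rmorphM.
  by rewrite mulfV ?rmorph1 ?pnatr_eq0.
by rewrite -!rmorphXn b3 rmorphM rmorphN rmorph_nat.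
Qed.

Lemma sum_of_four_cubes_xyz :
  sum_of_cubes 1 ('X_o0 * 'X_o1 * 'X_o2 : {mpoly R[i][3]}) 4.
Proof.
have [a a3] := cube_root _ (24%:R^-1 : R[i]).
pose X : {mpoly R[i][3]} := 'X_o0; pose Y : {mpoly R[i][3]} := 'X_o1.
pose Z : {mpoly R[i][3]} := 'X_o2.
have [hX hY hZ] : [/\ X \is 1.-homog, Y \is 1.-homog & Z \is 1.-homog].
  by split; rewrite dhomogX /= mdeg1.
apply: (@sum_of_cubes_tuple _ _ _ [tuple a%:MP * (X + Y + Z);
  a%:MP * (X - Y - Z); a%:MP * (Y - X - Z); a%:MP * (Z - X - Y)]).
  by rewrite /= !mul_mpolyC !dhomogZ //; do ![apply: rpredB | apply: rpredD].
apply: product_four_cubes.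
rewrite -rmorphXn a3 -(rmorph_nat (mpolyC 3 (R:=R[i]))) -rmorphM.
by rewrite mulfV ?rmorph1 ?pnatr_eq0.
Qed.

Lemma pure_cube_mnm (m : 'X_{1..3}) :
  pure_cube ('X_[m] : {mpoly R[i][3]}) <-> exists k, m = (k *+ 3)%MM.
Proof.
by split=> [[k]|[k ->]]; [rewrite mpolyXn => /mpolyX_inj | ]; exists k; rewrite ?mpolyXn.
Qed.

Lemma sum_of_two_cubes_pure d (m : 'X_{1..3}) :
  sum_of_cubes d ('X_[m] : {mpoly R[i][3]}) 2 -> pure_cube ('X_[m] : {mpoly R[i][3]}).
Proof.
move=> [g [_ E]]; apply/pure_cube_mnm.
by move: E; rewrite big_ord_recr big_ord1 => /esym; apply: two_cubes_monomial.
Qed.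

Lemma xyz_not_three_cubes :
  ~ sum_of_cubes 1 ('X_o0 * 'X_o1 * 'X_o2 : {mpoly R[i][3]}) 3.
Proof.
move=> [g [hg E]].
apply: (@product_not_three_cubes _ (\matrix_(i, j) (g j)@_U_(i))) => v.
have := congr1 (meval (fun i => v 0 i)) E; rewrite !mevalM !mevalXU raddf_sum => ->.
apply: eq_bigr => j _; rewrite /= rmorphXn /= linear_form_meval // mxE.
by congr (_ ^+ 3); apply: eq_bigr => i _; rewrite mxE.
Qed.

End SumsOfCubes.

Theorem proposition3p8 (R : realType) (a0 a1 a2 d : nat)
  (M : {mpoly R[i][3]})
  (hM : M = 'X_o0 ^+ a0 * 'X_o1 ^+ a1 * 'X_o2 ^+ a2)
  (hdeg : (a0 + a1 + a2 = 3 * d)%N) :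
  (pure_cube M -> waring3_rank_is d M 1) /\
  (M = 'X_o0 * 'X_o1 * 'X_o2 -> waring3_rank_is d M 4) /\
  (~ pure_cube M -> M <> 'X_o0 * 'X_o1 * 'X_o2 -> waring3_rank_is d M 3).
Proof.
pose m : 'X_{1..3} := (U_(o0) *+ a0 + U_(o1) *+ a1 + U_(o2) *+ a2)%MM.
have {hM} Mm : M = 'X_[m] by rewrite hM !mpolyXn -!mpolyXD.
have dm : mdeg m = (3 * d)%N by rewrite !mdegD !mdegMn !mdeg1; lia.
have xyzE : 'X_o0 * 'X_o1 * 'X_o2 = 'X_[(U_(o0) + U_(o1) + U_(o2))%MM] :> {mpoly R[i][3]}.
  by rewrite !mpolyXD.
rewrite {M}Mm; split; [|split].
- move=> cube; split; last first.
    case=> // -[g [_ /eqP]]; rewrite big_ord0.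
    by rewrite -msupp_eq0 msuppX.
  have [k mk] := (pure_cube_mnm _ _).1 cube.
  exists (fun=> 'X_[k]); split=> [_|]; last by rewrite big_ord1 mpolyXn mk.
  by rewrite dhomogX /=; move: dm; rewrite mk mdegMn => ?; apply/eqP; lia.
- rewrite {1}xyzE => /mpolyX_inj mE.
  have d1 : d = 1%N by move: dm; rewrite mE !mdegD !mdeg1; lia.
  rewrite mE -xyzE d1; split; first exact: sum_of_four_cubes_xyz.
  move=> t ht; rewrite ltnNge; apply/negP => t3.
  by apply: xyz_not_three_cubes; apply: sum_of_cubes_leq ht.
move=> ncube nxyz; split; last first.
  move=> t ht; rewrite ltnNge; apply/negP => t2; apply: ncube.
  exact: sum_of_two_cubes_pure (sum_of_cubes_leq _ _ _ _ _ t2 ht).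
have [|n [u [v [-> uv nu]]]] := exponent_decomposition d m dm.
  by move=> mE; apply: nxyz; rewrite mE xyzE.
exact: sum_of_three_cubes_mnm.
Qed.
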